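(* Let $\Delta\ge3$. For every finite graph $G$ of maximum degree at most $\Delta$, every $\lambda\ge1$ and every $\beta\ge0$, \[\eta_G(\beta,\lambda)\le\eta^+_{\Delta,\beta,\lambda}.\]
   Context: The Ising model on a finite graph $G$ at inverse temperature $\beta$ and activity $\lambda>0$ is the distribution $\mu_{G,\beta,\lambda}(\sigma)\propto e^{\frac{\beta}{2}\sum_{uv\in E(G)}\sigma_u\sigma_v}\lambda^{M(\sigma)}$ on $\sigma\in\{\pm1\}^{V(G)}$, where $M(\sigma)=\sum_v\sigma_v$. The mean magnetization is $\eta_G(\beta,\lambda)=\mathbb{E}_{\mu_{G,\beta,\lambda}}[M(\sigma)]/|V(G)|$. The quantity $\eta^+_{\Delta,\beta,\lambda}$ is the magnetization of the $+$ measure on the infinite $\Delta$-regular tree: $\eta^+_{\Delta,\beta,\lambda}=\tanh\big(L^*+\operatorname{artanh}(\tanh L^*\tanh\tfrac{\beta}{2})\big)$, where $L^*$ is the largest solution of $L^*=\log\lambda+(\Delta-1)\operatorname{artanh}(\tanh L^*\tanh\tfrac{\beta}{2})$. *)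

(* Defs.v *)
From HB Require Import structures.
From mathcomp Require Import all_boot all_order all_algebra.
From mathcomp Require Import all_classical all_reals.
From mathcomp Require Import sequences exp.
Set Implicit Arguments. Unset Strict Implicit. Unset Printing Implicit Defensive.
Import Order.TTheory GRing.Theory Num.Theory.
Local Open Scope ring_scope.

Section Ising.
Variable R : realType.

Definition tanh (x : R) : R := (expR x - expR (- x)) / (expR x + expR (- x)).
Definition artanh (y : R) : R := ln ((1 + y) / (1 - y)) / 2.

Definition simple_graph (T : finType) (e : rel T) : Prop :=
  symmetric e /\ irreflexive e.

Definition max_deg_le (T : finType) (e : rel T) (D : nat) : Prop :=
  forall v : T, (#|[set u | e v u]| <= D)%N.

Definition spin (T : finType) (s : {ffun T -> bool}) (v : T) : int :=
  if s v then 1 else -1.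

Definition magn (T : finType) (s : {ffun T -> bool}) : int :=
  \sum_(v : T) spin s v.

(* sum over unordered edges uv of sigma_u sigma_v = half the ordered sum *)
Definition edge_sum (T : finType) (e : rel T) (s : {ffun T -> bool}) : R :=
  (\sum_(u : T) \sum_(v : T | e u v) (spin s u * spin s v)%:~R) / 2.

Definition ising_weight (T : finType) (e : rel T) (beta lam : R)
    (s : {ffun T -> bool}) : R :=
  expR (beta / 2 * edge_sum e s) * lam ^ (magn s).

Definition partition_fn (T : finType) (e : rel T) (beta lam : R) : R :=
  \sum_(s : {ffun T -> bool}) ising_weight e beta lam s.

Definition mean_magnetization (T : finType) (e : rel T) (beta lam : R) : R :=
  (\sum_(s : {ffun T -> bool}) (magn s)%:~R * ising_weight e beta lam s)
    / partition_fn e beta lam / (#|T|)%:R.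

Definition tree_fixpoint (D : nat) (beta lam L : R) : Prop :=
  L = ln lam + (D.-1)%:R * artanh (tanh L * tanh (beta / 2)).

Definition largest_tree_fixpoint (D : nat) (beta lam L : R) : Prop :=
  tree_fixpoint D beta lam L /\
  forall L', tree_fixpoint D beta lam L' -> L' <= L.

(* eta^+_{Delta,beta,lambda} given L = L* *)
Definition eta_plus (beta L : R) : R :=
  tanh (L + artanh (tanh L * tanh (beta / 2))).

End Ising.

(* Main.v *)
(* Deleting an edge uw gives, with t = tanh (beta/2) and means taken in G - uw,
   <s_u>_G = (<s_u> + t <s_w>) / (1 + t <s_u s_w>).  Griffiths' second inequality
   <s_u s_w> >= <s_u><s_w> bounds this by the addition formula of tanh applied to
   <s_u> and t <s_w>.  By induction on the number of edges, a vertex of degree d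
   has mean at most tanh (ln lam + d a), where a = artanh (t tanh L); the induction
   closes because w has degree at most D - 1 in G - uw and L = ln lam + (D - 1) a,
   so <s_w> <= tanh L. *)

Require Import Defs.
From HB Require Import structures.
From mathcomp Require Import all_boot all_order all_algebra.
From mathcomp Require Import all_classical all_reals.
From mathcomp Require Import sequences exp.
From mathcomp Require Import ring lra.
Import Order.TTheory GRing.Theory Num.Theory.
Local Open Scope ring_scope.

(** * Hyperbolic tangent: monotonicity, addition formula, inverse *)

Section HyperbolicTangent.
Context {R : realType}.
Implicit Types x y : R.

(** Here [x] occurs only once, so monotonicity and the bound by 1 can be read off. *)
Lemma tanhE x : tanh x = 1 - 2 / (expR (x *+ 2) + 1).
Proof.
have px := expR_gt0 x.
rewrite /tanh expRN mulr2n expRD; field.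
by rewrite !gt_eqF ?addr_gt0 ?mulr_gt0.
Qed.

Lemma tanh0 : tanh 0 = 0 :> R.
Proof. by rewrite /tanh oppr0 subrr mul0r. Qed.

Lemma le_tanh x y : x <= y -> tanh x <= tanh y.
Proof.
move=> xy; rewrite !tanhE lerD2l lerN2 ler_pM2l // lef_pV2 ?posrE.
- by rewrite lerD2r ler_expR lerMn2r.
- by rewrite addr_gt0 ?expR_gt0.
- by rewrite addr_gt0 ?expR_gt0.
Qed.

Lemma tanh_ge0 x : 0 <= x -> 0 <= tanh x.
Proof. by move=> x0; rewrite -tanh0 le_tanh. Qed.

Lemma tanh_lt1 x : tanh x < 1.
Proof.
by rewrite tanhE gtrBl divr_gt0 ?addr_gt0 ?expR_gt0.
Qed.

Lemma tanhN x : tanh (- x) = - tanh x.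
Proof. by rewrite /tanh opprK -opprB mulNr [expR (- x) + expR x]addrC. Qed.

Lemma tanh_gtN1 x : -1 < tanh x.
Proof. by rewrite ltrNl -tanhN tanh_lt1. Qed.

Lemma tanhD x y :
  tanh (x + y) = (tanh x + tanh y) / (1 + tanh x * tanh y).
Proof.
have px := expR_gt0 x; have py := expR_gt0 y.
rewrite /tanh !expRN expRD; move: (expR x) (expR y) px py => p q p0 q0.
have pos (r : R) : 0 < r -> r * r + 1 != 0 by move=> r0; rewrite gt_eqF ?addr_gt0 ?mulr_gt0.
field; rewrite !pos ?mulr_gt0 // !gt_eqF //=.
have -> : (p * p + 1) * (q * q + 1) + (p * p - 1) * (q * q - 1) =
  2 * (p * q * (p * q) + 1) by ring.
by rewrite mulr_gt0 ?addr_gt0 ?mulr_gt0.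
Qed.

Lemma artanhK y : -1 < y -> y < 1 -> tanh (artanh y) = y.
Proof.
move=> y1 y2; rewrite tanhE /artanh -mulrnAr -[2^-1 *+ 2]mulr_natr mulVf ?pnatr_eq0 //.
have hp : 0 < 1 + y by lra.
have hm : 0 < 1 - y by lra.
rewrite mulr1 lnK ?posrE ?divr_gt0 //; field.
by rewrite gt_eqF //=; apply/eqP; lra.
Qed.

Lemma tanhK x : artanh (tanh x) = x.
Proof.
rewrite tanhE /artanh.
have px : 0 < expR (x *+ 2) by exact: expR_gt0.
have -> : (1 + (1 - 2 / (expR (x *+ 2) + 1))) / (1 - (1 - 2 / (expR (x *+ 2) + 1)))
  = expR (x *+ 2).
  by field; rewrite gt_eqF ?addr_gt0 //=; apply/eqP; lra.
by rewrite expRK -[x *+ 2]mulr_natr mulfK // pnatr_eq0.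
Qed.

Lemma le_artanh x y : -1 < x -> x <= y -> y < 1 -> artanh x <= artanh y.
Proof.
move=> x1 xy y1.
have xp : 0 < 1 + x by lra.
have yp : 0 < 1 + y by lra.
have xm : 0 < 1 - x by lra.
have ym : 0 < 1 - y by lra.
rewrite /artanh ler_pM2r ?invr_gt0 // ler_ln ?posrE ?divr_gt0 //.
rewrite ler_pM ?invr_ge0 ?(ltW xp) ?(ltW xm) ?lerD2l //.
by rewrite lef_pV2 ?posrE // lerD2l lerN2.
Qed.

Lemma artanh_ge0 x : 0 <= x -> x < 1 -> 0 <= artanh x.
Proof.
by move=> x0 x1; rewrite -[0]tanhK tanh0 le_artanh // ltrN10.
Qed.

End HyperbolicTangent.

(** * Sign of the largest solution of the tree recursion *)

Section TreeFixpoint.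
Context {R : realType}.

(* Knaster-Tarski: the recursion is monotone and bounded, so the supremum of
   its sub-solutions is a fixpoint, and [0] is a sub-solution. *)
Lemma largest_tree_fixpoint_ge0 (D : nat) (beta lam L : R) :
  1 <= lam -> 0 <= beta -> largest_tree_fixpoint D beta lam L -> 0 <= L.
Proof.
move=> lam1 beta0 [_ maxL].
have J0 : 0 <= beta / 2 by rewrite divr_ge0.
have t0 := tanh_ge0 _ J0; have t1 := tanh_lt1 (beta / 2).
pose f x := ln lam + (D.-1)%:R * artanh (tanh x * tanh (beta / 2)).
have th_lt1 x : tanh x * tanh (beta / 2) < 1.
  by have := tanh_lt1 x; have := tanh_gtN1 x; nra.
have th_gtN1 x : -1 < tanh x * tanh (beta / 2).
  by have := tanh_lt1 x; have := tanh_gtN1 x; nra.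
have f_mono x y : x <= y -> f x <= f y.
  move=> xy; rewrite lerD2l ler_wpM2l // le_artanh //.
  by rewrite ler_wpM2r // le_tanh.
pose S : set R := [set x | x <= f x]%classic.
have S0 : S 0.
  by rewrite /S /= /f tanh0 mul0r addr_ge0 ?ln_ge0 // mulr_ge0 // artanh_ge0.
have Sub : has_ubound S.
  (* Since [tanh x <= 1], the [artanh] term is at most [artanh (tanh (beta / 2))], which is
     [beta / 2]. *)
  exists (ln lam + (D.-1)%:R * (beta / 2)) => x Sx; apply: (le_trans Sx).
  rewrite lerD2l ler_wpM2l // -[leRHS]tanhK le_artanh //.
  by rewrite ler_piMl // ltW // tanh_lt1.
have le_supS x : S x -> x <= sup S by move=> Sx; apply: ub_le_sup.
have supS : sup S <= f (sup S).
  by apply: ge_sup; [exists 0 | move=> x Sx; apply/(le_trans Sx)/f_mono/le_supS].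
apply: (le_trans (le_supS _ S0)); apply: maxL; apply/eqP.
(* By monotonicity [f (sup S)] is a sub-solution too, hence at most [sup S]. *)
by rewrite eq_le supS le_supS //; apply: f_mono.
Qed.

End TreeFixpoint.

(** * Griffiths' inequalities for many-body ferromagnetic interactions *)

Section Griffiths.
Context {R : realType} {T : finType}.
Implicit Types (s r : {ffun T -> bool}) (l : seq T).

Definition spinR s v : R := (spin s v)%:~R.

Lemma spinRE s v : spinR s v = if s v then 1 else -1.
Proof. by rewrite /spinR /spin; case: (s v). Qed.

(** Characters of the group of spin configurations. Sites may repeat in [l], so a product of
    characters is a concatenation rather than a symmetric difference. *)
Definition chi l s : R := \prod_(v <- l) spinR s v.

Lemma spinR_sq s v : spinR s v * spinR s v = 1.
Proof. by rewrite spinRE; case: (s v); rewrite ?mulrNN mulr1. Qed.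

Lemma chi_cat l1 l2 s : chi (l1 ++ l2) s = chi l1 s * chi l2 s.
Proof. exact: big_cat. Qed.

Lemma chi1 v s : chi [:: v] s = spinR s v.
Proof. exact: big_seq1. Qed.

Lemma chi2 u v s : chi [:: u; v] s = spinR s u * spinR s v.
Proof. by rewrite /chi big_cons big_seq1. Qed.

Lemma chi_pm1 l s : chi l s = 1 \/ chi l s = -1.
Proof.
rewrite /chi; elim: l => [|v l [] IH]; rewrite ?big_nil ?big_cons ?IH; first by left.
  by rewrite spinRE; case: (s v); rewrite mulr1; [left|right].
by rewrite spinRE; case: (s v); rewrite ?mulrN1 ?opprK ?mul1r; [right|left].
Qed.

(** The sum factors over sites: a site of multiplicity [m] in [l] contributes [1 + (-1) ^+ m], which
    is 0 or 2. *)
Lemma sum_chi_ge0 l : 0 <= \sum_s chi l s.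
Proof.
have E s : chi l s = \prod_v (if s v then 1 else -1) ^+ count_mem v l.
  rewrite /chi; elim: l => [|u l IH]; first by rewrite big_nil big1.
  rewrite big_cons IH.
  under [RHS]eq_bigr do rewrite /= exprD.
  rewrite big_split /=; congr (_ * _).
  rewrite (bigD1 u) //= eqxx expr1 big1 ?mulr1.
    by rewrite spinRE; case: (s u).
  by move=> v vu; rewrite eq_sym (negbTE vu) expr0.
under eq_bigr do rewrite E.
rewrite -(bigA_distr_bigA (fun v (b : bool) => (if b then 1 else -1) ^+ count_mem v l)) /=.
apply: prodr_ge0 => v _; rewrite big_bool /= expr1n.
by rewrite -signr_odd; case: odd; rewrite ?expr0 ?expr1 ?subrr ?addr_ge0.
Qed.

(** Makes a Boltzmann factor affine in its character; the prefactor is the hyperbolic cosine of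
    [K]. *)
Lemma expR_pm1 (K x : R) : x = 1 \/ x = -1 ->
  expR (K * x) = (expR K + expR (- K)) / 2 * (1 + tanh K * x).
Proof.
have pk : expR K + expR (- K) != 0 by rewrite gt_eqF ?addr_gt0 ?expR_gt0.
by rewrite /tanh; case=> ->; rewrite ?mulrN1 ?mulr1; field.
Qed.

Definition gibbs (I : finType) (K : I -> R) (c : I -> seq T) s : R :=
  expR (\sum_i K i * chi (c i) s).

(* Each factor [expR (K i * chi)] is a nonnegative multiple of
   [1 + tanh (K i) * chi], so the product expands into characters with
   nonnegative coefficients. *)
Lemma griffiths1 (I : finType) (K : I -> R) (c : I -> seq T) l :
  (forall i, 0 <= K i) ->
  0 <= \sum_s chi l s * gibbs I K c s.
Proof.
move=> K0; rewrite /gibbs /index_enum; move: (Finite.enum I) => E.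
(* [l] stays general because expanding the factor of [i] appends [c i] to it. *)
elim: E l => [|i E IH] l.
  by under eq_bigr do rewrite big_nil expR0 mulr1; exact: sum_chi_ge0.
pose C := (expR (K i) + expR (- K i)) / 2.
have C0 : 0 <= C by rewrite divr_ge0 ?addr_ge0 ?expR_ge0.
under eq_bigr => s _.
  rewrite big_cons expRD expR_pm1; last exact: chi_pm1.
  rewrite -/C.
  have -> : chi l s * (C * (1 + tanh (K i) * chi (c i) s)
      * expR (\sum_(j <- E) K j * chi (c j) s)) =
    C * (chi l s * expR (\sum_(j <- E) K j * chi (c j) s))
   + C * tanh (K i) *
     (chi (l ++ c i) s * expR (\sum_(j <- E) K j * chi (c j) s)).
    by rewrite chi_cat; ring.
  over.
rewrite big_split -!mulr_sumr /=.
apply: addr_ge0; apply: mulr_ge0; rewrite ?IH //.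
by rewrite mulr_ge0 ?tanh_ge0.
Qed.

(** Pointwise product of spins: two booleans agree exactly when their signs multiply to 1. *)
Definition twist r s : {ffun T -> bool} := [ffun v => s v == r v].

Lemma twistK r : involutive (twist r).
Proof. by move=> s; apply/ffunP => v; rewrite !ffunE; case: (s v); case: (r v). Qed.

Lemma spinR_twist r s v : spinR (twist r s) v = spinR s v * spinR r v.
Proof.
rewrite !spinRE ffunE.
by case: (s v); case: (r v) => /=; rewrite ?mulrNN ?mulr1 ?mul1r.
Qed.

Lemma chi_twist r s l : chi l (twist r s) = chi l s * chi l r.
Proof. by rewrite /chi -big_split; apply: eq_bigr => v _; exact: spinR_twist. Qed.

(* Ginibre's duplication: in the pair [(s, twist r s)] the doubled system at
   fixed [r] is again ferromagnetic, with couplings [K i * (1 + chi (c i) r)]. *)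
Lemma griffiths2 (I : finType) (K : I -> R) (c : I -> seq T) l1 l2 :
  (forall i, 0 <= K i) ->
  (\sum_s chi l1 s * gibbs I K c s) * (\sum_s chi l2 s * gibbs I K c s) <=
  (\sum_s gibbs I K c s) * (\sum_s chi (l1 ++ l2) s * gibbs I K c s).
Proof.
move=> K0; set w := gibbs I K c.
rewrite -subr_ge0 [X in X - _]mulrC !mulr_suml -sumrB.
(* Substitute [t = twist s r] for the second copy. Then [chi l2 t = chi l2 s * chi l2 r], and
   [1 - chi l2 r] factors out. *)
have -> : \sum_s (chi (l1 ++ l2) s * w s * (\sum_t w t) -
    chi l1 s * w s * (\sum_t chi l2 t * w t)) =
  \sum_r (1 - chi l2 r) * \sum_s chi (l1 ++ l2) s * (w s * w (twist r s)).
  under [RHS]eq_bigr do rewrite mulr_sumr.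
  rewrite exchange_big /=; apply: eq_bigr => s _.
  rewrite !mulr_sumr -sumrB (reindex_inj (inv_inj (twistK s))) /=.
  apply: eq_bigr => r _; rewrite chi_cat chi_twist.
  have -> : twist s r = twist r s by apply/ffunP => v; rewrite !ffunE eq_sym.
  ring.
apply: sumr_ge0 => r _; apply: mulr_ge0.
  by rewrite subr_ge0; case: (chi_pm1 l2 r) => ->; lra.
have := griffiths1 I (fun i => K i * (1 + chi (c i) r)) c (l1 ++ l2).
under eq_bigr => s _.
  have -> : gibbs I (fun i => K i * (1 + chi (c i) r)) c s = w s * w (twist r s).
    rewrite /w /gibbs -expRD -big_split; congr expR; apply: eq_bigr => i _ /=.
    by rewrite chi_twist; ring.
  over.
apply=> i; rewrite mulr_ge0 //.
by case: (chi_pm1 (c i) r) => ->; lra.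
Qed.

End Griffiths.

(** * Deleting an edge: degrees and number of edges *)

Section EdgeDeletion.
Context {T : finType}.
Implicit Types (e : rel T).

Definition del_edge e (u w : T) : rel T :=
  [rel x y | [&& e x y, (x, y) != (u, w) & (x, y) != (w, u)]].

Lemma del_edge_simple e u w : simple_graph e -> simple_graph (del_edge e u w).
Proof.
move=> [sym irr]; split=> [x y|x]; rewrite /del_edge /=; last by rewrite irr.
by rewrite sym !xpair_eqE ![(x == _) && _]andbC [X in _ && X]andbC.
Qed.

Lemma degree_del_edge_le e u w x :
  (#|[set y | del_edge e u w x y]| <= #|[set y | e x y]|)%N.
Proof. by apply/subset_leq_card/fintype.subsetP => y; rewrite !inE /del_edge /= => /and3P[]. Qed.

Lemma degree_del_edgel e u w : e u w ->
  #|[set y | e u y]| = #|[set y | del_edge e u w u y]|.+1.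
Proof.
move=> euw; rewrite (cardsD1 w) inE euw; congr (_.+1); apply: eq_card => y.
rewrite !inE /del_edge /= !xpair_eqE eqxx /=.
case: (eqVneq y w) => [->|yw] //=; first by rewrite andbF.
case: (eqVneq u w) => [uw|] /=; last by rewrite andbT.
by case: (eqVneq y u) => [yu|]; rewrite ?andbT //; rewrite yu uw eqxx in yw.
Qed.

Lemma degree_del_edger e u w : symmetric e -> e u w ->
  #|[set y | e w y]| = #|[set y | del_edge e u w w y]|.+1.
Proof.
move=> sym euw; rewrite (@degree_del_edgel e w u) 1?sym //; congr (_.+1).
by apply: eq_card => y; rewrite !inE /del_edge /= [X in _ && X]andbC.
Qed.

Lemma card_edges_del_edge e u w : e u w ->
  (#|[set p | del_edge e u w p.1 p.2]| < #|[set p | e p.1 p.2]|)%N.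
Proof.
move=> euw; apply/proper_card/properP; split.
  by apply/fintype.subsetP => p; rewrite !inE /del_edge /= => /and3P[].
by exists (u, w); rewrite !inE /del_edge //= eqxx andbF.
Qed.

End EdgeDeletion.

(** * The Ising model as a ferromagnetic Gibbs system *)

Section Ising.
Context {R : realType} {T : finType}.
Implicit Types (e : rel T) (s : {ffun T -> bool}) (beta lam : R).

Local Notation spinR := (@spinR R T).

Lemma edge_sumE e s :
  edge_sum R e s = (\sum_(p | e p.1 p.2) spinR s p.1 * spinR s p.2) / 2.
Proof.
rewrite /edge_sum pair_big_dep /=.
by congr (_ / 2); apply: eq_bigr => p _; rewrite intrM.
Qed.

Lemma edge_sum_del_edge e u w s : simple_graph e -> e u w ->
  edge_sum R e s = edge_sum R (del_edge e u w) s + spinR s u * spinR s w.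
Proof.
(* The edge gives two ordered pairs, distinct because there are no loops; the factor 1/2 counts them
   once. *)
move=> [sym irr] euw; rewrite !edge_sumE (bigD1 (u, w)) //= (bigD1 (w, u)) /=.
  rewrite (eq_bigl (fun p => del_edge e u w p.1 p.2)).
    by rewrite [spinR s w * _]mulrC; field.
  by case=> x y /=; rewrite -andbA.
rewrite sym euw xpair_eqE; apply/negP => /andP[/eqP wu _].
by rewrite wu irr in euw.
Qed.

Lemma ising_weightE e beta lam s : 0 < lam ->
  ising_weight e beta lam s =
  expR (beta / 2 * edge_sum R e s + ln lam * \sum_v spinR s v).
Proof.
move=> lam0; rewrite /ising_weight expRD; congr (_ * _).
rewrite -powR_intmul ?(ltW lam0) // /powR gt_eqF // mulrC.
by rewrite /magn raddf_sum.
Qed.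

Lemma ising_weight_gt0 e beta lam s : 0 < lam -> 0 < ising_weight e beta lam s.
Proof. by move=> lam0; rewrite ising_weightE // expR_gt0. Qed.

Lemma partition_fn_gt0 e beta lam : 0 < lam -> 0 < partition_fn e beta lam.
Proof.
move=> lam0; rewrite /partition_fn (bigD1 [ffun=> true]) //=.
rewrite ltr_wpDr ?ising_weight_gt0 //.
by apply: sumr_ge0 => s _; rewrite ltW ?ising_weight_gt0.
Qed.

(* Each unordered edge occurs as two ordered pairs, hence the coupling [beta / 4]. *)
Definition coupling e beta lam (i : T * T + T) : R :=
  match i with
  | inl p => if e p.1 p.2 then beta / 4 else 0
  | inr _ => ln lam
  end.

(** The external field enters as one-site interactions, so Griffiths' inequalities treat edges and
    field together. *)
Definition interaction_sites (i : T * T + T) : seq T :=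
  match i with inl p => [:: p.1; p.2] | inr v => [:: v] end.

Lemma ising_weight_gibbs e beta lam s : 0 < lam ->
  ising_weight e beta lam s = gibbs _ (coupling e beta lam) interaction_sites s.
Proof.
move=> lam0; rewrite ising_weightE // /gibbs big_sumType /=.
congr expR; congr (_ + _).
  rewrite edge_sumE [X in _ * (X / _)]big_mkcond mulr_suml mulr_sumr; apply: eq_bigr => p _.
  by rewrite chi2; case: ifP => _; rewrite ?mul0r ?mulr0 ?mul0r //; field.
by rewrite mulr_sumr; apply: eq_bigr => v _; rewrite chi1.
Qed.

Lemma coupling_ge0 e beta lam i : 0 <= beta -> 1 <= lam ->
  0 <= coupling e beta lam i.
Proof.
by move=> b0 l1; case: i => [p|v] /=; rewrite ?ln_ge0 //; case: ifP; rewrite ?divr_ge0.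
Qed.

Definition site_mean e beta lam v : R :=
  (\sum_s spinR s v * ising_weight e beta lam s) / partition_fn e beta lam.

Definition pair_mean e beta lam u v : R :=
  (\sum_s spinR s u * spinR s v * ising_weight e beta lam s) / partition_fn e beta lam.

Lemma site_mean_ge0 e beta lam v : 0 <= beta -> 1 <= lam ->
  0 <= site_mean e beta lam v.
Proof.
move=> b0 l1; have l0 : 0 < lam by rewrite (lt_le_trans _ l1).
apply: divr_ge0; last by rewrite ltW ?partition_fn_gt0.
under eq_bigr do rewrite ising_weight_gibbs // -chi1.
by apply: griffiths1 => i; apply: coupling_ge0.
Qed.

Lemma site_mean_mul_le e beta lam u v : 0 <= beta -> 1 <= lam ->
  site_mean e beta lam u * site_mean e beta lam v <= pair_mean e beta lam u v.
Proof.
move=> b0 l1; have l0 : 0 < lam by rewrite (lt_le_trans _ l1).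
have Z0 := partition_fn_gt0 e beta _ l0.
rewrite /site_mean /pair_mean mulf_div ler_pdivrMr ?mulr_gt0 // mulrA divfK ?gt_eqF //.
rewrite [leRHS]mulrC.
have := griffiths2 _ (coupling e beta lam) interaction_sites [:: u] [:: v]
  (fun i => coupling_ge0 e beta lam i b0 l1).
have -> : gibbs _ (coupling e beta lam) interaction_sites = ising_weight e beta lam.
  by apply/funext => s; rewrite ising_weight_gibbs.
have -> : chi ([:: u] ++ [:: v]) = (fun s => spinR s u * spinR s v).
  by apply/funext => s; rewrite chi2.
have c1 x : chi [:: x] = spinR^~ x by apply/funext => s; rewrite chi1.
by rewrite !c1.
Qed.

End Ising.

(** * Bounding the mean spin by edge deletion *)

Section MagnetizationBound.
Context {R : realType} {T : finType}.
Implicit Types (e : rel T) (s : {ffun T -> bool}) (beta lam : R).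

Local Notation spinR := (@spinR R T).

Lemma ising_weight_del_edge e beta lam u w s : 0 < lam -> simple_graph e -> e u w ->
  ising_weight e beta lam s =
  (expR (beta / 2) + expR (- (beta / 2))) / 2 *
  (1 + tanh (beta / 2) * (spinR s u * spinR s w)) *
  ising_weight (del_edge e u w) beta lam s.
Proof.
move=> l0 sg euw; rewrite !ising_weightE // (edge_sum_del_edge e u w s sg euw).
rewrite -chi2 -expR_pm1; last exact: chi_pm1.
by rewrite -expRD mulrDr; congr expR; rewrite [in RHS]addrA; congr (_ + _); rewrite addrC.
Qed.

(** Expand numerator and partition function by [ising_weight_del_edge]. The spin at [u] squares to
    1, so the numerator gains the sum for [w]; the common factor [C] cancels. *)
Lemma site_mean_del_edge e beta lam u w : 0 <= beta -> 1 <= lam ->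
  simple_graph e -> e u w ->
  site_mean e beta lam u =
  (site_mean (del_edge e u w) beta lam u
     + tanh (beta / 2) * site_mean (del_edge e u w) beta lam w)
  / (1 + tanh (beta / 2) * pair_mean (del_edge e u w) beta lam u w).
Proof.
move=> b0 l1 sg euw; have l0 : 0 < lam by rewrite (lt_le_trans _ l1).
have Z0 := partition_fn_gt0 (del_edge e u w) beta _ l0.
have Z1 := partition_fn_gt0 e beta _ l0.
rewrite /site_mean /pair_mean.
set Z := partition_fn (del_edge e u w) beta lam in Z0 *.
set C : R := (expR (beta / 2) + expR (- (beta / 2))) / 2.
have C0 : 0 < C by rewrite divr_gt0 ?addr_gt0 ?expR_gt0.
set Su := \sum_s spinR s u * ising_weight (del_edge e u w) beta lam s.
set Sw := \sum_s spinR s w * ising_weight (del_edge e u w) beta lam s.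
set Suw := \sum_s spinR s u * spinR s w * ising_weight (del_edge e u w) beta lam s.
have EZ : partition_fn e beta lam = C * (Z + tanh (beta / 2) * Suw).
  rewrite /partition_fn /Z /partition_fn /Suw mulr_sumr -big_split mulr_sumr.
  by apply: eq_bigr => s _ /=; rewrite (ising_weight_del_edge e beta lam u w) // -/C; ring.
have ES : \sum_s spinR s u * ising_weight e beta lam s = C * (Su + tanh (beta / 2) * Sw).
  rewrite /Su /Sw mulr_sumr -big_split mulr_sumr.
  apply: eq_bigr => s _ /=; rewrite (ising_weight_del_edge e beta lam u w) // -/C.
  have sq : spinR s u * spinR s u = 1 := spinR_sq s u; ring: sq.
(* Positivity is inherited from the partition function of [e]. *)
have D0 : 0 < Z + tanh (beta / 2) * Suw by rewrite -(pmulr_rgt0 _ C0) -EZ.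
rewrite ES EZ; field.
by rewrite !gt_eqF.
Qed.

Lemma tanh_addition_mono (a b x y : R) : 0 <= a -> a <= x -> x < 1 ->
  0 <= b -> b <= y -> y < 1 -> (a + b) / (1 + a * b) <= (x + y) / (1 + x * y).
Proof.
move=> a0 ax x1 b0 byy y1.
have x0 := le_trans a0 ax; have y0 := le_trans b0 byy.
have a1 : a <= 1 by exact: le_trans ax (ltW x1).
have b1 : b <= 1 by exact: le_trans byy (ltW y1).
have by1 : b * y <= 1 by rewrite mulr_ile1 // ltW.
have ax1 : a * x <= 1 by rewrite mulr_ile1 // ltW.
have ab0 : 0 <= a * b by rewrite mulr_ge0.
have xy0 : 0 <= x * y by rewrite mulr_ge0.
have h1 : 0 <= (x - a) * (1 - b * y) by rewrite mulr_ge0 ?subr_ge0.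
have h2 : 0 <= (y - b) * (1 - a * x) by rewrite mulr_ge0 ?subr_ge0.
rewrite ler_pdivrMr ?ltr_wpDr // mulrAC ler_pdivlMr ?ltr_wpDr //.
rewrite -subr_ge0.
have -> : (x + y) * (1 + a * b) - (a + b) * (1 + x * y) =
  (x - a) * (1 - b * y) + (y - b) * (1 - a * x) by ring.
exact: addr_ge0.
Qed.

(* By Griffiths' second inequality, replacing the pair correlation by the
   product of the means only decreases the denominator. *)
Lemma site_mean_edge_le e beta lam u w : 0 <= beta -> 1 <= lam ->
  simple_graph e -> e u w ->
  let a := site_mean (del_edge e u w) beta lam u in
  let b := tanh (beta / 2) * site_mean (del_edge e u w) beta lam w in
  site_mean e beta lam u <= (a + b) / (1 + a * b).
Proof.
move=> b0 l1 sg euw /=; rewrite (site_mean_del_edge e beta lam u w) //.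
set a := site_mean _ _ _ u; set b := site_mean _ _ _ w; set t := tanh _.
have t0 : 0 <= t by rewrite tanh_ge0 ?divr_ge0.
have a0 : 0 <= a by exact: site_mean_ge0.
have b0' : 0 <= b by exact: site_mean_ge0.
have tab0 : 0 <= t * (a * b) by exact: mulr_ge0 t0 (mulr_ge0 a0 b0').
have num0 : 0 <= a + t * b by exact: addr_ge0 a0 (mulr_ge0 t0 b0').
have tab : t * (a * b) <= t * pair_mean (del_edge e u w) beta lam u w.
  by rewrite ler_wpM2l // site_mean_mul_le.
rewrite ler_wpM2l // [a * _]mulrCA.
by rewrite lef_pV2 ?posrE ?lerD2l // ltr_wpDr // (le_trans tab0).
Qed.

(** Base case of the induction. Without the field at [u], the weight [B] is invariant under flipping
    [u], so this spin behaves like a single spin in field [ln lam]. *)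
Lemma site_mean_isolated e beta lam u : 0 < lam -> (forall x y, e x y -> x != u /\ y != u) ->
  site_mean e beta lam u = tanh (ln lam).
Proof.
move=> l0 iso.
pose B s := ising_weight e beta lam s * expR (- (ln lam * spinR s u)).
(* The twisting configuration is -1 at [u] only. *)
pose flip := twist [ffun v => v != u].
have spinR_flip s v : spinR (flip s) v = if v == u then - spinR s v else spinR s v.
  rewrite spinR_twist [X in _ * X]spinRE ffunE.
  by case: eqP => _; rewrite /= ?mulrN1 ?mulr1.
have Bflip s : B (flip s) = B s.
  rewrite /B !ising_weightE // -!expRD; congr expR.
  have -> : edge_sum R e (flip s) = edge_sum R e s.
    rewrite !edge_sumE; congr (_ / 2); apply: eq_bigr => p ep.
    by have [xu yu] := iso _ _ ep; rewrite !spinR_flip (negbTE xu) (negbTE yu).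
  rewrite (bigD1 u) //= [\sum_v spinR s v](bigD1 u) //=.
  rewrite (eq_bigr (spinR s)); last by move=> v vu; rewrite spinR_flip (negbTE vu).
  by ring.
have SB0 : \sum_s spinR s u * B s = 0.
  have : \sum_s spinR s u * B s = - \sum_s spinR s u * B s.
    rewrite {1}(reindex_inj (inv_inj (twistK [ffun v => v != u]))) -sumrN.
    by apply: eq_bigr => s _; rewrite Bflip spinR_flip eqxx mulNr.
  lra.
pose C : R := (expR (ln lam) + expR (- ln lam)) / 2.
have C0 : 0 < C by rewrite divr_gt0 ?addr_gt0 ?expR_gt0.
have wE s : ising_weight e beta lam s = C * (B s + tanh (ln lam) * (spinR s u * B s)).
  have -> : ising_weight e beta lam s = B s * expR (ln lam * spinR s u).
    by rewrite /B -mulrA -expRD addNr expR0 mulr1.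
  by rewrite -chi1 expR_pm1 -/C; [ring|exact: chi_pm1].
have EZ : partition_fn e beta lam = C * \sum_s B s.
  rewrite /partition_fn (eq_bigr _ (fun s _ => wE s)) -mulr_sumr big_split -mulr_sumr /=.
  by rewrite SB0 mulr0 addr0.
have SB : 0 < \sum_s B s.
  by have := partition_fn_gt0 e beta _ l0; rewrite EZ pmulr_rgt0.
rewrite /site_mean EZ.
have -> : \sum_s spinR s u * ising_weight e beta lam s = C * (tanh (ln lam) * \sum_s B s).
  transitivity (C * (\sum_s spinR s u * B s + tanh (ln lam) * \sum_s B s)).
    rewrite mulr_sumr -big_split mulr_sumr; apply: eq_bigr => s _ /=.
    have sq : spinR s u * spinR s u = 1 := spinR_sq s u; rewrite wE; ring: sq.
  by rewrite SB0 add0r.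
by field; rewrite !gt_eqF.
Qed.

(** The bound keeps the exact degree of [u], so each deletion removes one summand [a], while [D] and
    [L] stay fixed throughout the induction. *)
Lemma site_mean_le_tanh (D : nat) beta lam L a : (0 < D)%N -> 0 <= beta -> 1 <= lam ->
  0 <= a -> tanh a = tanh L * tanh (beta / 2) -> L = ln lam + (D.-1)%:R * a ->
  forall e, simple_graph e -> max_deg_le e D -> forall u,
  site_mean e beta lam u <= tanh (ln lam + #|[set v | e u v]|%:R * a).
Proof.
move=> D0 b0 l1 a0 ta LE e.
have l0 : 0 < lam by rewrite (lt_le_trans _ l1).
have t0 : 0 <= tanh (beta / 2) by rewrite tanh_ge0 ?divr_ge0.
have [n] := ubnP #|[set p : T * T | e p.1 p.2]|.
elim: n e => // n IH e en sg deg u.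
have [sym irr] := sg.
case: (pickP [pred w | e u w]) => [w /= euw|no_nbr].
  pose e' := del_edge e u w.
  have e'n : (#|[set p : T * T | e' p.1 p.2]| < n)%N.
    exact: leq_trans (card_edges_del_edge _ _ _ euw) en.
  have sg' : simple_graph e' by exact: del_edge_simple.
  have deg' : max_deg_le e' D.
    by move=> x; apply: leq_trans (deg x); exact: degree_del_edge_le.
  have IHu := IH e' e'n sg' deg' u.
  have IHw : site_mean e' beta lam w <= tanh L.
    apply: (le_trans (IH e' e'n sg' deg' w)); rewrite LE le_tanh // lerD2l ler_wpM2r //.
    by rewrite ler_nat -ltnS prednK // -degree_del_edger.
  (* Splitting off one [a] gives the target the form [(x + y) / (1 + x * y)] with
     [y = tanh L * tanh (beta / 2)]. *)
  rewrite (degree_del_edgel _ _ _ euw) -natr1 mulrDl mul1r addrA tanhD ta.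
  apply: (le_trans (site_mean_edge_le _ _ _ _ _ b0 l1 sg euw)).
  apply: tanh_addition_mono => //.
  - exact: site_mean_ge0.
  - exact: tanh_lt1.
  - by rewrite mulr_ge0 ?site_mean_ge0.
  - by rewrite mulrC ler_wpM2r.
  - by rewrite -ta tanh_lt1.
have -> : #|[set v | e u v]| = 0%N by apply: eq_card0 => v; rewrite inE; exact: no_nbr.
rewrite mul0r addr0 site_mean_isolated // => x y exy.
by split; apply/eqP => E; move: (no_nbr x) (no_nbr y); rewrite /= -E ?exy // sym exy.
Qed.

Lemma mean_magnetizationE e beta lam :
  mean_magnetization e beta lam = (\sum_v site_mean e beta lam v) / #|T|%:R.
Proof.
rewrite /mean_magnetization /site_mean -mulr_suml; congr (_ / _ / _).
rewrite exchange_big; apply: eq_bigr => s _ /=.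
by rewrite -mulr_suml /magn raddf_sum.
Qed.

End MagnetizationBound.

Theorem theorem3 (R : realType) (D : nat) (hD : (3 <= D)%N)
  (T : finType) (e : rel T) (hG : simple_graph e) (hdeg : max_deg_le e D)
  (lam beta : R) (hlam : 1 <= lam) (hbeta : 0 <= beta)
  (Lstar : R) (hL : largest_tree_fixpoint D beta lam Lstar) :
  mean_magnetization e beta lam <= eta_plus beta Lstar.
Proof.
have D0 : (0 < D)%N by exact: leq_trans hD.
have L0 := largest_tree_fixpoint_ge0 _ _ _ _ hlam hbeta hL.
have [LE _] := hL.
pose a := artanh (tanh Lstar * tanh (beta / 2)).
have t0 : 0 <= tanh (beta / 2) by rewrite tanh_ge0 ?divr_ge0.
have tL0 := tanh_ge0 _ L0.
have p0 : 0 <= tanh Lstar * tanh (beta / 2) by rewrite mulr_ge0.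
have p1 : tanh Lstar * tanh (beta / 2) < 1.
  by have := tanh_lt1 Lstar; have := tanh_lt1 (beta / 2); nra.
have a0 : 0 <= a by exact: artanh_ge0.
have ta : tanh a = tanh Lstar * tanh (beta / 2).
  by rewrite artanhK // (lt_le_trans _ p0) // ltrN10.
have site v : site_mean e beta lam v <= eta_plus beta Lstar.
  apply: (le_trans (site_mean_le_tanh D _ _ _ _ D0 hbeta hlam a0 ta LE _ hG hdeg v)).
  (* By the fixpoint equation [Lstar + a] equals [ln lam + D%:R * a], so degree at most [D]
     suffices. *)
  rewrite /eta_plus -/a le_tanh // {1}LE -/a -addrA lerD2l.
  rewrite -[X in _ <= _ + X]mul1r -mulrDl natr1 prednK // ler_wpM2r // ler_nat.
  exact: hdeg.
rewrite mean_magnetizationE; have [T0|T0] := posnP #|T|.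
  (* On the empty graph, division by 0 makes the mean magnetization 0, and [eta_plus] is
     nonnegative. *)
  by rewrite T0 invr0 mulr0 tanh_ge0 // addr_ge0.
rewrite ler_pdivrMr ?ltr0n //.
apply: (le_trans (ler_sum _ (fun v _ => site v))).
by rewrite sumr_const mulr_natr.
Qed.
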